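(* Let $Q$ be a polynomial ring over a field and let $I$ be a proper monomial ideal of $Q$ with minimal monomial generators $m_1,\dots,m_q$. For any $i\in\mathbb{Z}$, we have $$\beta_i^Q(Q/I)\le\binom{q}{i}-\binom{q-\operatorname{Scarf-number}(I)}{i-\operatorname{Scarf-number}(I)}.$$ Moreover, equality holds for every integer $i$ if and only if $Q/I$ has a minimal pivot resolution.
   Context: Notation. $[q]=\{1,\dots,q\}$, $\mathcal{P}([q])$ is its power set. For $A\subseteq[q]$ put $m_A=\operatorname{lcm}(m_i : i\in A)$, with $m_\emptyset=1$. Binomial coefficients $\binom{a}{b}$ with $b<0$ or $b>a$ are $0$, and by convention $\binom{-\infty}{-\infty}=0$ (so the second binomial is $0$ when the Scarf number is $\infty$). Scarf number. $\operatorname{Scarf-number}(I)=\inf\{t\in\mathbb{N} : \exists\,\tau,\tau'\in\mathcal{P}([q])\text{ with }\tau\ne\tau',\ |\tau|=t,\ m_\tau=m_{\tau'}\}$ (equal to $\infty$ if no such $t$ exists). Betti numbers. A graded free resolution $\mathcal{F}$ is minimal if $\partial(F_i)\subseteq\mathfrak{m}F_{i-1}$ for all $i$, where $\mathfrak{m}$ is the ideal generated by the variables of $Q$; $\beta_i^Q(Q/I)$ is the rank of the $i$-th module in a minimal graded free resolution of $Q/I$ over $Q$ ($0$ for $i<0$). Taylor resolution. $\mathcal{T}$ is the complex of free $Q$-modules whose degree-$i$ component has basis $\{\epsilon_\tau : \tau\in\mathcal{P}([q]),\ |\tau|=i\}$ ($\epsilon_\tau$ in the multidegree of $m_\tau$),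 with differential $\partial(\epsilon_\tau)=\sum_{j\in\tau}(-1)^{|\{k\in\tau : k<j\}|}\frac{m_\tau}{m_{\tau\setminus\{j\}}}\epsilon_{\tau\setminus\{j\}}$. It is a free resolution of $Q/I$. Pivot complexes. A pivot complex of $Q/I$ is either $\mathcal{T}$ itself or, for some integer $l\ge2$ and $i_1<\dots<i_l$ in $[q]$, the subcomplex $\mathcal{T}_{i_1,\dots,i_l}$ of $\mathcal{T}$ spanned over $Q$ by the $\epsilon_\sigma$ with $\sigma\nsupseteq\{i_1,\dots,i_l\}$. A pivot resolution of $Q/I$ is a pivot complex that is a free resolution of $Q/I$ ($H_0=Q/I$, $H_i=0$ for $i>0$); it is a minimal pivot resolution if it is moreover minimal. *)

(* Defs.v *)
From HB Require Import structures.
From mathcomp Require Import all_boot all_order all_algebra.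
From mathcomp Require Import mpoly.
From Stdlib Require Import ClassicalEpsilon.

Set Implicit Arguments.
Unset Strict Implicit.
Unset Printing Implicit Defensive.

Import GRing.Theory.
Local Open Scope ring_scope.

Section Ideals.
Variables (k : fieldType) (n : nat).
Local Notation Q := {mpoly k[n]}.

Definition ideal_gen (J : finType) (g : J -> Q) (A : {set J}) (p : Q) : Prop :=
  exists c : J -> Q, p = \sum_(j in A) c j * g j.

Definition irrelevant_ideal : Q -> Prop := ideal_gen (fun i : 'I_n => 'X_i) setT.

Definition monomial_ideal q (m : 'I_q -> 'X_{1..n}) (A : {set 'I_q}) : Q -> Prop :=
  ideal_gen (fun i => 'X_[k, m i]) A.

(* For q = 0 this says I = 0.  Repeated or redundant monomials are excluded,
   since they could be dropped. *)
Definition minimal_monomial_generators (I : Q -> Prop) q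
    (m : 'I_q -> 'X_{1..n}) : Prop :=
  (forall p, I p <-> monomial_ideal m setT p) /\
  (forall A : {set 'I_q}, (forall p, I p <-> monomial_ideal m A p) -> A = setT).

Definition ideal_proper (I : Q -> Prop) : Prop := ~ I 1.

(* All nonzero terms have total degree e; the zero polynomial qualifies for
   every e, and is the only one to do so when e < 0. *)
Definition homogeneous (e : int) (p : Q) : Prop :=
  forall u, u \in msupp p -> (mdeg u)%:Z = e.

End Ideals.

Section Resolutions.
Variables (k : fieldType) (n : nat).
Local Notation Q := {mpoly k[n]}.

(* Data of a sequence of based free Q-modules of finite rank: the i-th module
   is {ffun gen i -> Q}, its basis element a has degree gdeg a, and
   coef a b is the coefficient of b in the differential of a. *)
Record based_complex := BasedComplex {
  gen : nat -> finType;
  gdeg : forall i, gen i -> int;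
  coef : forall i, gen i.+1 -> gen i -> Q }.

Definition rank (F : based_complex) (i : nat) : nat := #|gen F i|.

Definition bd (F : based_complex) i (v : {ffun gen F i.+1 -> Q}) :
    {ffun gen F i -> Q} :=
  [ffun b => \sum_a v a * coef a b].

(* A Q-linear map from the free module F_0 to Q/I is given by representatives
   aug b in Q of the images of the basis elements b. *)
Definition augment (F : based_complex) (aug : gen F 0 -> Q)
    (v : {ffun gen F 0 -> Q}) : Q :=
  \sum_b v b * aug b.

(* Differentials and augmentation are homogeneous of degree 0 for the standard
   grading of Q. *)
Definition graded (F : based_complex) (aug : gen F 0 -> Q) : Prop :=
  (forall b, homogeneous (gdeg b) (aug b)) /\
  (forall i (a : gen F i.+1) (b : gen F i),
     homogeneous (gdeg a - gdeg b) (coef a b)).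

(* Exactness of ... -> F_1 -> F_0 -> Q/I -> 0. *)
Definition resolves (I : Q -> Prop) (F : based_complex) (aug : gen F 0 -> Q) :
    Prop :=
  [/\ forall p, exists v, I (augment aug v - p),
      forall v, I (augment aug v) <-> exists w, v = bd w
    & forall i (v : {ffun gen F i.+1 -> Q}), bd v = 0 <-> exists w, v = bd w].

Definition graded_free_resolution (I : Q -> Prop) (F : based_complex) : Prop :=
  exists2 aug : gen F 0 -> Q, graded aug & resolves I aug.

Definition minimal (F : based_complex) : Prop :=
  forall i (v : {ffun gen F i.+1 -> Q}) (b : gen F i),
    irrelevant_ideal (bd v b).

Definition betti_spec (I : Q -> Prop) (i b : nat) : Prop :=
  exists F : based_complex,
    [/\ graded_free_resolution I F, minimal F & rank F i = b].

(* Minimal graded free resolutions of Q/I exist, for I a homogeneous ideal, and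
   are unique up to isomorphism, so the choice made here is immaterial. *)
Definition betti_nat (I : Q -> Prop) (i : nat) : nat :=
  match excluded_middle_informative (exists b, betti_spec I i b) with
  | left h => proj1_sig (constructive_indefinite_description _ h)
  | right _ => 0
  end.

Definition betti (I : Q -> Prop) (i : int) : nat :=
  match i with Posz j => betti_nat I j | Negz _ => 0 end.

End Resolutions.

Section Taylor.
Variables (k : fieldType) (n q : nat) (m : 'I_q -> 'X_{1..n}).
Local Notation Q := {mpoly k[n]}.

Definition lcm_mon (A : {set 'I_q}) : 'X_{1..n} :=
  \big[@mlcm n/0%MM]_(i in A) m i.

Definition taylor_coef (s t : {set 'I_q}) : Q :=
  \sum_(j in s | t == s :\ j)
     (-1) ^+ #|[set l in s | (l < j)%N]| *
     'X_[k, (lcm_mon s - lcm_mon (s :\ j))%MM].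

(* The part of the Taylor complex spanned by the epsilon_s with P s.  It is a
   subcomplex whenever P is stable under taking subsets. *)
Definition taylor_part (P : pred {set 'I_q}) : based_complex k n :=
  @BasedComplex k n
    (fun i => {s : {set 'I_q} | (#|s| == i) && P s})
    (fun i s => (mdeg (lcm_mon (val s)))%:Z)
    (fun i s t => taylor_coef (val s) (val t)).

Definition taylor_complex : based_complex k n := taylor_part predT.

Definition taylor_avoiding (S : {set 'I_q}) : based_complex k n :=
  taylor_part (fun s => ~~ (S \subset s)).

Definition pivot_complex (F : based_complex k n) : Prop :=
  F = taylor_complex \/
  exists2 S : {set 'I_q}, (2 <= #|S|)%N & F = taylor_avoiding S.

Definition has_minimal_pivot_resolution (I : Q -> Prop) : Prop :=
  exists F, [/\ pivot_complex F, graded_free_resolution I F & minimal F].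

End Taylor.

Section Scarf.
Variables (n q : nat) (m : 'I_q -> 'X_{1..n}).

Definition repeated_label (s : {set 'I_q}) : bool :=
  [exists s' : {set 'I_q}, (s != s') && (lcm_mon m s == lcm_mon m s')].

(* None stands for infinity. *)
Definition scarf_number : option nat :=
  if [pick s | repeated_label s] is Some s0
  then Some #|[arg min_(s < s0 | repeated_label s) #|s| ]|
  else None.

End Scarf.

Definition binz (a b : int) : int :=
  if (0 <= b) && (b <= a) then 'C(absz a, absz b)%:Z else 0.

Definition shifted_binz (q : nat) (i : int) (s : option nat) : int :=
  if s is Some t then binz (q%:Z - t%:Z) (i - t%:Z) else 0.

(* Main.v *)
(* A minimal free resolution is, up to homotopy, a retract of any other
   resolution, so its ranks are bounded by those of every resolution, and a
   resolution with the same ranks is minimal.  In each multidegree u of I,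
   a subset-closed part of the Taylor complex is a simplicial complex,
   and it is contractible as soon as some j with m_j | u can be added to all of
   its faces.  Hence T_S resolves Q/I exactly when some m_j with j outside S
   divides m_S.  A smallest repeated label S has this property, and T_S then has
   the ranks of the theorem.  Conversely, if T_S resolves Q/I then S is a
   repeated label, so the Scarf number is at most |S|, with equality when T_S is
   minimal by comparison of ranks. *)

Require Import Defs.
From mathcomp Require Import all_boot all_order all_algebra.
From mathcomp Require Import mpoly.
From Stdlib Require Import ClassicalEpsilon.

Set Implicit Arguments.
Unset Strict Implicit.
Unset Printing Implicit Defensive.

Import Order.TTheory GRing.Theory Num.Theory.
Local Open Scope ring_scope.

(** * Linear maps between free modules with finite bases *)

Section FreeModuleMaps.
Variable R : comNzRingType.
Implicit Types A B C : finType.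

Definition lin A B (f : A -> {ffun B -> R}) (v : {ffun A -> R}) :
    {ffun B -> R} :=
  [ffun b => \sum_a v a * f a b].

Definition basis_vec A (a : A) : {ffun A -> R} := [ffun x => (x == a)%:R].

Lemma lin_basis_vec A B (f : A -> {ffun B -> R}) a : lin f (basis_vec a) = f a.
Proof.
apply/ffunP=> b; rewrite ffunE (bigD1 a) //= ffunE eqxx mul1r big1 ?addr0 //.
by move=> x /negPf xa; rewrite ffunE xa mul0r.
Qed.

Lemma lin_comp A B C (f : A -> {ffun B -> R}) (g : B -> {ffun C -> R}) v :
  lin g (lin f v) = lin (fun a => lin g (f a)) v.
Proof.
apply/ffunP=> c; rewrite !ffunE.
under eq_bigr do rewrite ffunE mulr_suml.
rewrite exchange_big; apply: eq_bigr => a _; rewrite ffunE mulr_sumr.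
by apply: eq_bigr => b _; rewrite mulrA.
Qed.

Lemma lin0 A B (f : A -> {ffun B -> R}) : lin f 0 = 0.
Proof.
by apply/ffunP=> b; rewrite !ffunE big1 // => a _; rewrite ffunE mul0r.
Qed.

Lemma linB A B (f : A -> {ffun B -> R}) v w : lin f (v - w) = lin f v - lin f w.
Proof.
apply/ffunP=> b; rewrite !ffunE -sumrB; apply: eq_bigr => a _ /=.
by rewrite !ffunE mulrBl.
Qed.

Lemma lin_funB A B (f g : A -> {ffun B -> R}) v :
  lin (fun a => f a - g a) v = lin f v - lin g v.
Proof.
apply/ffunP=> b; rewrite !ffunE -sumrB; apply: eq_bigr => a _ /=.
by rewrite !ffunE mulrBr.
Qed.

Lemma lin_id A v : lin (@basis_vec A) v = v.
Proof.
apply/ffunP=> b; rewrite ffunE (bigD1 b) //= ffunE eqxx mulr1 big1 ?addr0 //.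
by move=> x /negPf xb; rewrite ffunE eq_sym xb mulr0.
Qed.

Lemma eq_lin A B (f g : A -> {ffun B -> R}) : f =1 g -> lin f =1 lin g.
Proof.
by move=> fg v; apply/ffunP=> b; rewrite !ffunE; apply: eq_bigr => a _; rewrite fg.
Qed.

End FreeModuleMaps.

(** * Ideals of the polynomial ring and the irrelevant ideal *)

Section Ideal.
Variables (k : fieldType) (n : nat).
Local Notation Q := {mpoly k[n]}.

Definition is_ideal (I : Q -> Prop) : Prop :=
  [/\ I 0, forall p r, I p -> I r -> I (p + r) & forall p r, I r -> I (p * r)].

Lemma ideal_gen_is_ideal (J : finType) (g : J -> Q) (A : {set J}) :
  is_ideal (ideal_gen g A).
Proof.
split=> [|p r [c ->] [d ->]|p r [c ->]].
- by exists (fun=> 0); rewrite big1 // => j _; rewrite mul0r.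
- exists (fun j => c j + d j); rewrite -big_split; apply: eq_bigr => j _ /=.
  by rewrite mulrDl.
- exists (fun j => p * c j); rewrite mulr_sumr; apply: eq_bigr => j _.
  by rewrite mulrA.
Qed.

Lemma eq_is_ideal (I J : Q -> Prop) :
  (forall p, I p <-> J p) -> is_ideal J -> is_ideal I.
Proof.
move=> IJ [j0 jD jM]; split=> [|p r /IJ Ip /IJ Ir|p r /IJ Ir]; apply/IJ => //.
  exact: jD.
exact: jM.
Qed.

Lemma ideal_gen_mem (J : finType) (g : J -> Q) (A : {set J}) j :
  j \in A -> ideal_gen g A (g j).
Proof.
move=> jA; exists (fun l => (l == j)%:R); rewrite (bigD1 j) //= eqxx mul1r.
by rewrite big1 ?addr0 // => l /andP[_ /negPf ->]; rewrite mul0r.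
Qed.

Section Closure.
Variables (I : Q -> Prop) (idealI : is_ideal I).

Lemma ideal_sum (J : Type) (s : seq J) (P : pred J) (f : J -> Q) :
  (forall j, P j -> I (f j)) -> I (\sum_(j <- s | P j) f j).
Proof. by case: (idealI) => i0 iD _ If; apply: big_ind. Qed.

End Closure.

(** Each nonconstant monomial is divisible by a variable. Membership thus becomes a condition on the
    residue in [k], which turns minimality into linear algebra over [k]. *)
Lemma irrelevant_idealP (p : Q) : irrelevant_ideal p <-> p@_0%MM = 0.
Proof.
split=> [[c ->]|p0].
  rewrite raddf_sum big1 //= => i _; rewrite rmorphM /= mcoeffX.
  by rewrite mnm1_eq0 mulr0.
have [i0 iD iM] := ideal_gen_is_ideal (fun i : 'I_n => 'X_i : Q) setT.
rewrite (mpolyE p) big_seq; apply: ideal_sum => // u.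
rewrite mcoeff_msupp => pu; have /forallPn[i ui] : ~~ [forall i, u i == 0%N].
  apply: contra pu => /forallP u0; have -> : u = 0%MM.
    by apply/mnmP=> i; rewrite mnm0E; apply/eqP.
  by rewrite p0.
have -> : u = (u - U_(i) + U_(i))%MM by rewrite submK // lep1mP.
rewrite mpolyXD scalerAl; apply: iM; exact: ideal_gen_mem.
Qed.

End Ideal.

(** * Comparison of resolutions: chain maps and homotopies *)

Section Comparison.
Variables (k : fieldType) (n : nat) (I : {mpoly k[n]} -> Prop).
Local Notation Q := {mpoly k[n]}.
Hypothesis idealI : is_ideal I.

Definition bd_basis (F : based_complex k n) i (a : gen F i.+1) :
    {ffun gen F i -> Q} :=
  [ffun b => coef a b].

Lemma bd_lin (F : based_complex k n) i (v : {ffun gen F i.+1 -> Q}) :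
  bd v = lin (@bd_basis F i) v.
Proof. by apply/ffunP=> b; rewrite !ffunE; apply: eq_bigr => a _; rewrite ffunE. Qed.

Lemma augment_lin (F G : based_complex k n) (aug : gen G 0 -> Q)
    (f : gen F 0 -> {ffun gen G 0 -> Q}) v :
  augment aug (lin f v) = augment (fun a => augment aug (f a)) v.
Proof.
rewrite /augment; under eq_bigr do rewrite ffunE mulr_suml.
rewrite exchange_big; apply: eq_bigr => a _; rewrite mulr_sumr.
by apply: eq_bigr => b _; rewrite mulrA.
Qed.

Section Lift.
Variables (F G : based_complex k n) (augF : gen F 0 -> Q) (augG : gen G 0 -> Q).
Hypotheses (resF : resolves I augF) (resG : resolves I augG).

(** A chain map over the identity of Q/I. [epsilon] picks the preimages that exactness of [G]
    provides; that they exist is checked in [lift_augment] and [lift_bd]. *)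
Fixpoint lift i : gen F i -> {ffun gen G i -> Q} :=
  match i with
  | 0 => fun b => epsilon (inhabits 0) (fun w => I (augment augG w - augF b))
  | j.+1 => fun a =>
      epsilon (inhabits 0) (fun w => bd w = lin (@lift j) (bd_basis a))
  end.

Lemma lift_augment v : I (augment augG (lin (@lift 0) v) - augment augF v).
Proof.
have [iM] := idealI; rewrite augment_lin /augment -sumrB => iD iMul.
apply: ideal_sum => // a _; rewrite -mulrBr; apply: iMul.
have [surG _ _] := resG; exact: epsilon_spec (surG (augF a)).
Qed.

(** By linearity basis elements suffice. The lift of a boundary is a cycle, since the square
    commutes one degree lower and the differential of [F] squares to zero; exactness of [G] then
    gives the preimage. In degree 0, membership of the augmentation in [I] replaces the cycle
    condition. *)
Lemma lift_bd i v : bd (lin (@lift i.+1) v) = lin (@lift i) (bd v).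
Proof.
suff Hb (a : gen F i.+1) : bd (lift a) = lin (@lift i) (bd_basis a).
  rewrite !bd_lin !lin_comp; apply: eq_lin => a; rewrite -Hb.
  by rewrite bd_lin.
elim: i {v} a => [|i IH] a; refine (@epsilon_spec _ _ (fun w => bd w = _) _).
  have [_ exG _] := resG; have [_ exF _] := resF.
  suff /exG[w Hw] : I (augment augG (lin (@lift 0) (bd_basis a))) by exists w.
  have Ia : I (augment augF (bd_basis a)).
    by apply/exF; exists (basis_vec _ a); rewrite bd_lin lin_basis_vec.
  have [_ iD _] := idealI.
  by rewrite -[X in I X](subrK (augment augF (bd_basis a))); apply: iD => //;
     apply: lift_augment.
have [_ _ exG] := resG; have [_ _ exF] := resF.
suff /exG[w Hw] : bd (lin (@lift i.+1) (bd_basis a)) = 0 by exists w.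
rewrite bd_lin lin_comp -(@eq_lin _ _ _ (fun b => bd (lift b))); last first.
  by move=> b; rewrite bd_lin.
rewrite (@eq_lin _ _ _ _ (fun b => lin (@lift i) (bd_basis b))); last first.
  exact: IH.
rewrite -lin_comp -bd_lin; suff -> : bd (bd_basis a) = 0 by rewrite lin0.
by apply/exF; exists (basis_vec _ a); rewrite bd_lin lin_basis_vec.
Qed.

End Lift.

Section Homotopy.
Variables (F G : based_complex k n) (augF : gen F 0 -> Q) (augG : gen G 0 -> Q).
Hypotheses (resF : resolves I augF) (resG : resolves I augG).
Variable theta : forall i, gen F i -> {ffun gen G i -> Q}.
Hypothesis theta_aug : forall v, I (augment augG (lin (@theta 0) v)).
Hypothesis theta_bd :
  forall i v, bd (lin (@theta i.+1) v) = lin (@theta i) (bd v).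

(** A null homotopy for a chain map [theta] that covers the zero map of Q/I. *)
Fixpoint homotopy i : gen F i -> {ffun gen G i.+1 -> Q} :=
  match i with
  | 0 => fun b => epsilon (inhabits 0) (fun w => bd w = theta b)
  | j.+1 => fun a => epsilon (inhabits 0)
      (fun w => bd w = theta a - lin (@homotopy j) (bd_basis a))
  end.

Lemma homotopy0 a : theta a = bd (@homotopy 0 a).
Proof.
symmetry; refine (@epsilon_spec _ _ (fun w => bd w = _) _); have [_ exG _] := resG.
have /exG[w Hw] := theta_aug (basis_vec _ a).
by exists w; rewrite -Hw lin_basis_vec.
Qed.

(** The right-hand side of the defining equation of [homotopy] is a cycle: the relation one degree
    lower shows that both of its terms have the same boundary. Exactness of [G] then gives the
    preimage. *)
Lemma homotopyS i (a : gen F i.+1) :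
  theta a = bd (homotopy a) + lin (@homotopy i) (bd_basis a).
Proof.
suff -> : bd (homotopy a) = theta a - lin (@homotopy i) (bd_basis a).
  by rewrite subrK.
have [_ _ exG] := resG; have [_ _ exF] := resF.
have bda0 j (b : gen F j.+2) : bd (bd_basis b) = 0.
  by apply/exF; exists (basis_vec _ b); rewrite bd_lin lin_basis_vec.
have bdth j (b : gen F j.+1) : bd (theta b) = lin (@theta j) (bd_basis b).
  by rewrite -(lin_basis_vec (@theta j.+1)) theta_bd bd_lin lin_basis_vec.
elim: i a => [|i IH] a; refine (@epsilon_spec _ _ (fun w => bd w = _) _).
  suff /exG[w Hw] : bd (theta a - lin (@homotopy 0) (bd_basis a)) = 0.
    by exists w.
  rewrite bd_lin linB -!bd_lin bdth (bd_lin (lin _ _)) lin_comp.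
  apply/eqP; rewrite subr_eq0; apply/eqP; apply: eq_lin => b.
  by rewrite homotopy0 bd_lin.
suff /exG[w Hw] : bd (theta a - lin (@homotopy i.+1) (bd_basis a)) = 0.
  by exists w.
rewrite bd_lin linB -!bd_lin bdth (bd_lin (lin _ _)) lin_comp.
rewrite (@eq_lin _ _ _ (fun b => lin _ (homotopy b))
   (fun b => theta b - lin (@homotopy i) (bd_basis b))); last first.
  by move=> b; rewrite -bd_lin IH.
by rewrite lin_funB -lin_comp -bd_lin bda0 lin0 subr0 subrr.
Qed.

End Homotopy.

End Comparison.

(** * Reduction modulo the irrelevant ideal, ranks and Betti numbers *)

Section MinimalRank.
Variables (k : fieldType) (n : nat) (I : {mpoly k[n]} -> Prop).
Local Notation Q := {mpoly k[n]}.
Hypothesis idealI : is_ideal I.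

(** The matrix of the map tensored with [k], acting on row vectors, so that composites become
    products in diagrammatic order. *)
Definition residue_mx (A B : finType) (f : A -> {ffun B -> Q}) :
    'M[k]_(#|A|, #|B|) :=
  \matrix_(i, j) (f (enum_val i) (enum_val j))@_0%MM.

Lemma residue_mx_comp (A B C : finType) (f : A -> {ffun B -> Q})
    (g : B -> {ffun C -> Q}) :
  residue_mx (fun a => lin g (f a)) = residue_mx f *m residue_mx g.
Proof.
apply/matrixP=> i j; rewrite !mxE ffunE raddf_sum /=.
rewrite (reindex _ (onW_bij _ (@enum_val_bij B))) /=.
by apply: eq_bigr => l _; rewrite !mxE rmorphM.
Qed.

Lemma residue_mx_basis (A : finType) : residue_mx (@basis_vec Q A) = 1%:M.
Proof.
apply/matrixP=> i j; rewrite !mxE ffunE (inj_eq enum_val_inj) eq_sym.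
by case: eqP => _; rewrite ?mcoeff1 ?mcoeff0 ?eqxx.
Qed.

Lemma minimal_bd_basis (F : based_complex k n) :
  minimal F <-> forall i, residue_mx (@bd_basis k n F i) = 0.
Proof.
split=> [minF i|H i v b].
  apply/matrixP=> a b; rewrite !mxE -(lin_basis_vec (@bd_basis _ _ F i)) -bd_lin.
  exact/irrelevant_idealP/minF.
apply/irrelevant_idealP; rewrite ffunE raddf_sum big1 //= => a _.
rewrite rmorphM /=; have /matrixP/(_ (enum_rank a) (enum_rank b)) := H i.
by rewrite !mxE !enum_rankK ffunE => ->; rewrite mulr0.
Qed.

Section Residue.
Variables (F G : based_complex k n) (augF : gen F 0 -> Q) (augG : gen G 0 -> Q).
Hypotheses (resF : resolves I augF) (resG : resolves I augG) (minF : minimal F).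

(* The composite of F -> G -> F is homotopic to the identity, and the
   differentials of F vanish modulo the irrelevant ideal. *)
Lemma residue_lift_retract i :
  residue_mx (@lift _ _ I F G augF augG i) *m
  residue_mx (@lift _ _ I G F augG augF i) = 1%:M.
Proof.
set phi := @lift _ _ I F G augF augG; set psi := @lift _ _ I G F augG augF.
pose theta j a := lin (@psi j) (@phi j a) - basis_vec _ a.
have thE j v : lin (@theta j) v = lin (@psi j) (lin (@phi j) v) - v.
  by rewrite lin_funB lin_comp lin_id.
have th_aug v : I (augment augF (lin (@theta 0) v)).
  rewrite thE; have -> : augment augF (lin (@psi 0) (lin (@phi 0) v) - v) =
      (augment augF (lin (@psi 0) (lin (@phi 0) v)) -
       augment augG (lin (@phi 0) v)) +
      (augment augG (lin (@phi 0) v) - augment augF v).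
    rewrite addrA subrK /augment -sumrB; apply: eq_bigr => a _.
    by rewrite !ffunE mulrBl.
  have [_ iD _] := idealI; apply: iD; first exact (lift_augment idealI augG resF _).
  exact (lift_augment idealI augF resG _).
have th_bd j v : bd (lin (@theta j.+1) v) = lin (@theta j) (bd v).
  rewrite !thE bd_lin linB -!bd_lin.
  by rewrite (lift_bd idealI resG resF) (lift_bd idealI resF resG).
rewrite -residue_mx_comp -residue_mx_basis; apply/matrixP=> a b; rewrite !mxE.
apply/eqP; rewrite -subr_eq0 -raddfB /=; apply/eqP.
move: (enum_val a) (enum_val b) => x y.
have -> : lin (@psi i) (phi i x) y - basis_vec _ x y = theta i x y.
  by rewrite !ffunE.
have mF j v (z : gen F j) : (bd v z)@_0%MM = 0 by exact/irrelevant_idealP/minF.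
case: i x y {a b} => [|i] x y.
  by rewrite (homotopy0 resF th_aug) mF.
rewrite (homotopyS resF resF th_aug th_bd) ffunE raddfD /= mF add0r.
rewrite ffunE raddf_sum big1 //= => c _; rewrite rmorphM /=.
by rewrite -(lin_basis_vec (@bd_basis _ _ F i)) -bd_lin mF mul0r.
Qed.

(** A matrix over a field with a right inverse has at least as many columns as rows. *)
Lemma minimal_rank_le i : (rank F i <= rank G i)%N.
Proof. exact: mulmx1_min (residue_lift_retract i). Qed.

(** Equal ranks make the residue of the lift from [F] to [G] cancellable on the left. It intertwines
    the residual differentials, and that of [F] vanishes, so that of [G] does too. *)
Lemma minimal_of_rank_eq : (forall i, rank F i = rank G i) -> minimal G.
Proof.
move=> rkE; apply/minimal_bd_basis => i.
have full : row_full (residue_mx (@lift _ _ I F G augF augG i.+1)).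
  rewrite -col_leq_rank -[X in (X <= _)%N](rkE i.+1).
  apply: (@mulmx1_min_rank _ _ _ _ _ 1%:M
    (residue_mx (@lift _ _ I G F augG augF i.+1))).
  by rewrite mul1mx residue_lift_retract.
apply: (row_full_inj full); rewrite mulmx0.
have -> : residue_mx (@lift _ _ I F G augF augG i.+1) *m
          residue_mx (@bd_basis _ _ G i) =
          residue_mx (@bd_basis _ _ F i) *m
          residue_mx (@lift _ _ I F G augF augG i).
  rewrite -!residue_mx_comp; apply/matrixP=> a b; rewrite !mxE.
  rewrite -bd_lin -{1}(lin_basis_vec (@lift _ _ I F G augF augG i.+1)).
  by rewrite (lift_bd idealI resF resG) bd_lin lin_basis_vec.
by have /minimal_bd_basis -> := minF; rewrite mul0mx.
Qed.

End Residue.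

(** The choice inside [betti_nat] is harmless: two minimal resolutions bound each other's ranks. *)
Lemma betti_natE (F : based_complex k n) :
  graded_free_resolution I F -> minimal F ->
  forall i, betti_nat I i = rank F i.
Proof.
move=> [aF grF resF] minF i; rewrite /betti_nat.
case: excluded_middle_informative => [h|[]]; last first.
  by exists (rank F i), F; split=> //; exists aF.
case: constructive_indefinite_description => /= _ [G [[aG _ resG] minG <-]].
apply/eqP; rewrite eqn_leq.
by rewrite (minimal_rank_le resF resG) // (minimal_rank_le resG resF).
Qed.

Lemma betti_nat_le (G : based_complex k n) (augG : gen G 0 -> Q) :
  resolves I augG -> forall i, (betti_nat I i <= rank G i)%N.
Proof.
move=> resG i; rewrite /betti_nat.
(* The default value 0 satisfies the bound trivially. *)
case: excluded_middle_informative => // h.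
case: constructive_indefinite_description => /= _ [F [[aF _ resF] minF <-]].
exact: minimal_rank_le resF resG minF i.
Qed.

(** A positive rank in degree 0 excludes the default value 0 of [betti_nat], and so produces a
    minimal resolution with which [G] can be compared. *)
Lemma betti_nat_minimal (G : based_complex k n) (augG : gen G 0 -> Q) :
  resolves I augG -> (0 < rank G 0)%N ->
  (forall i, betti_nat I i = rank G i) -> minimal G.
Proof.
move=> resG G0 rkE; have [F gF minF] :
    exists2 F, graded_free_resolution I F & minimal F.
  move: G0; rewrite -rkE /betti_nat.
  case: excluded_middle_informative => // -[b [F [gF minF _]]] _.
  by exists F.
have [aF _ resF] := gF; apply: (minimal_of_rank_eq resF resG minF) => i.
by rewrite -rkE (betti_natE gF minF).
Qed.

End MinimalRank.

(** * Least common multiples of monomials *)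

Section MonomialLcm.
Variables (n q : nat) (m : 'I_q -> 'X_{1..n}).
Local Notation L := (lcm_mon m).
Implicit Types (s t : {set 'I_q}) (j l : 'I_q).

Lemma lcm_mon_leP s u : reflect (forall j, j \in s -> (m j <= u)%MM) (L s <= u)%MM.
Proof.
rewrite /lcm_mon; have -> : (\big[@mlcm n/0]_(i in s) m i <= u)%MM =
    \big[andb/true]_(i in s) (m i <= u)%MM.
  apply: (big_morph (fun v => (v <= u)%MM)) => [x y|]; first exact: lem_mlcm.
  by apply/mnm_lepP => i; rewrite mnm0E.
by rewrite big_andE; apply: (iffP forall_inP).
Qed.

Lemma lcm_mon_ge s j : j \in s -> (m j <= L s)%MM.
Proof. by apply/lcm_mon_leP; exact: lepm_refl. Qed.

Lemma lcm_mon_sub s t : s \subset t -> (L s <= L t)%MM.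
Proof. by move/subsetP=> st; apply/lcm_mon_leP => j /st; exact: lcm_mon_ge. Qed.

Lemma lcm_mon0 : L set0 = 0%MM.
Proof. by rewrite /lcm_mon big_set0. Qed.

Lemma lepm_anti (u v : 'X_{1..n}) : (u <= v)%MM -> (v <= u)%MM -> u = v.
Proof.
move=> /mnm_lepP uv /mnm_lepP vu; apply/mnmP => i; apply/eqP.
by rewrite eqn_leq uv vu.
Qed.

Lemma lcm_mon1 j : L [set j] = m j.
Proof.
apply: lepm_anti; last exact/lcm_mon_ge/set11.
by apply/lcm_mon_leP => l /set1P ->; exact: lepm_refl.
Qed.

Lemma lcm_monU1_le j s u : (L (j |: s) <= u)%MM = (m j <= u)%MM && (L s <= u)%MM.
Proof.
apply/lcm_mon_leP/andP=> [H|[ju /lcm_mon_leP su] l /setU1P[->|]//]; last exact: su.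
by split; [apply: H; rewrite setU11 | apply/lcm_mon_leP => l ls; apply/H/setU1r].
Qed.

Lemma lcm_monU1_id j s : (m j <= L s)%MM -> L (j |: s) = L s.
Proof.
move=> js; apply: lepm_anti; last exact/lcm_mon_sub/subsetUr.
by rewrite lcm_monU1_le js lepm_refl.
Qed.

End MonomialLcm.

(** * The augmented chain complex of a simplex and its cones *)

Section SimplicialCone.
Variables (R : comNzRingType) (q : nat).
Implicit Types (s t : {set 'I_q}) (j l : 'I_q) (c : {set 'I_q} -> R).

(** For [j] outside [s], this is the sign of the facet [s] in the boundary of [j |: s]. *)
Definition incidence j s : R := (-1) ^+ #|[set l in s | (l < j)%N]|.

(** Chains are coefficient functions on all subsets, the empty face included, with all degrees
    together. The value at [t] collects the simplices that have [t] as a facet. *)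
Definition simplicial_bd c t : R :=
  \sum_(j | j \notin t) incidence j t * c (j |: t).

Lemma incidenceU1 j l s : l \notin s ->
  incidence j (l |: s) = (-1) ^+ (l < j)%N * incidence j s.
Proof.
move=> ls; rewrite /incidence -exprD; congr (_ ^+ _).
case: ltnP => lj /=.
  have -> : [set i in l |: s | (i < j)%N] = l |: [set i in s | (i < j)%N].
    by apply/setP=> i; rewrite !inE andb_orl; case: eqP => // ->; rewrite lj.
  by rewrite cardsU1 !inE (negPf ls).
apply: eq_card => i; rewrite !inE andb_orl; case: eqP => //= ->.
by rewrite ltnNge lj andbF.
Qed.

Lemma incidence_sqr j s : incidence j s * incidence j s = 1.
Proof. by rewrite -expr2 /incidence -exprM mulnC exprM sqrrN !expr1n. Qed.

Lemma incidence_swap j l s : j != l -> j \notin s -> l \notin s ->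
  incidence j s * incidence l (j |: s) = - (incidence l s * incidence j (l |: s)).
Proof.
move=> jl js ls; rewrite !incidenceU1 //.
have -> : (j < l)%N = ~~ (l < j)%N.
  by move: jl; rewrite -(inj_eq val_inj) /=; case: ltngtP.
rewrite signrN mulrCA mulNr [in RHS]mulrCA; congr (- (_ * _)); exact: mulrC.
Qed.

Lemma simplicial_bd_bd c : simplicial_bd (simplicial_bd c) =1 fun=> 0.
Proof.
move=> t; pose f j l := incidence j t * (incidence l (j |: t) * c (l |: (j |: t))).
pose A j l := [&& j \notin t, l \notin t & j != l].
have -> : simplicial_bd (simplicial_bd c) t = \sum_j \sum_(l | A j l) f j l.
  rewrite /simplicial_bd big_mkcond; apply: eq_bigr => j _; rewrite /A.
  case: ifP => jt; last by rewrite big_pred0.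
  rewrite mulr_sumr; apply: eq_bigl => l.
  by rewrite !inE negb_or andbC eq_sym.
have fC j l : A j l -> f l j = - f j l.
  case/and3P=> jt lt jl; rewrite /f !mulrA incidence_swap 1?eq_sym //.
  by rewrite mulNr setUCA.
(* The terms with [l < j] are rewritten by antisymmetry; after exchanging the two summations they
   cancel those with [j < l]. *)
have split_sum (j : 'I_q) : \sum_(l | A j l) f j l =
    \sum_(l | A j l && (j < l)%N) f j l - \sum_(l | A j l && (l < j)%N) f l j.
  rewrite (bigID (fun l : 'I_q => (j < l)%N)) /= -sumrN; congr (_ + _).
  apply: eq_big => [l|l /andP[/fC ->]]; last by rewrite opprK.
  by rewrite /A; case: (ltngtP j l) => [||/val_inj ->]; rewrite ?eqxx ?andbF.
under eq_bigr do rewrite split_sum.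
rewrite big_split sumrN /= [X in _ - X](exchange_big_dep xpredT) //=.
apply/eqP; rewrite subr_eq0; apply/eqP; apply: eq_bigr => j _.
apply: eq_bigl => l; rewrite /A eq_sym; by case: (j \in t); rewrite ?andbF.
Qed.

Definition cone j c s : R :=
  if j \in s then incidence j (s :\ j) * c (s :\ j) else 0.

(** Coning with apex [j] is a contracting homotopy, so it fills every cycle. At faces without [j]
    only the term that adds [j] survives. *)
Lemma simplicial_bd_cone j c :
  simplicial_bd c =1 (fun=> 0) -> simplicial_bd (cone j c) =1 c.
Proof.
move=> bc t; have [jt|jt] := boolP (j \in t); last first.
  rewrite /simplicial_bd (bigD1 j) //= big1 ?addr0.
    by rewrite /cone setU11 setU1K // mulrA incidence_sqr mul1r.
  move=> l /andP[lt lj]; rewrite /cone in_setU1 eq_sym (negPf lj) (negPf jt).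
  by rewrite mulr0.
(* At a face containing [j], the cycle condition on the facet opposite [j] expresses [c t] through
   the coefficients that occur in the boundary of the cone. *)
have /eqP := bc (t :\ j); rewrite /simplicial_bd (bigD1 j) ?setD11 //=.
rewrite setD1K // addr_eq0 => /eqP ct.
rewrite -[RHS]mul1r -(incidence_sqr j (t :\ j)) -mulrA ct mulrN mulr_sumr -sumrN.
apply: eq_big => [l|l lt].
  by rewrite in_setD1 negb_and negbK; case: eqP => [->|] //=; rewrite ?jt ?andbT.
have lj : l != j by apply: contraNneq lt => ->.
rewrite /cone in_setU1 jt orbT.
have -> : (l |: t) :\ j = l |: (t :\ j).
  by apply/setP=> i; rewrite !inE; case: (i =P l) => [->|] //=; rewrite lj.
have ltj : l \notin t :\ j by rewrite !inE negb_and lt orbT.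
rewrite -{1}(setD1K jt) !mulrA -[in RHS]mulNr; congr (_ * _).
rewrite !incidenceU1 ?setD11 //; have := lj; rewrite -(inj_eq val_inj) /=.
by case: ltngtP => //= _ _; rewrite ?mul1r ?mulN1r ?mulNr ?mulrN mulrC.
Qed.

End SimplicialCone.

(** * Exactness of parts of the Taylor complex, one multidegree at a time *)

Section TaylorExactness.
Variables (k : fieldType) (n q : nat) (m : 'I_q -> 'X_{1..n}).
Local Notation Q := {mpoly k[n]}.
Local Notation L := (lcm_mon m).
Implicit Types (s t : {set 'I_q}) (j l : 'I_q) (w z : {set 'I_q} -> Q).
Implicit Types (c : {set 'I_q} -> k) (u : 'X_{1..n}).

(** The Taylor differential on functions defined on all subsets, which avoids the subtypes indexing
    the bases of [taylor_part]; [taylor_coefE] links the two. *)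
Definition taylor_bd w t : Q :=
  \sum_(j | j \notin t) incidence Q j t * w (j |: t) * 'X_[(L (j |: t) - L t)%MM].

Lemma mcoeffMXE (p : Q) u v :
  (p * 'X_[u])@_v = if (u <= v)%MM then p@_(v - u) else 0.
Proof.
case: ifP => uv; first by rewrite -{1}(submK uv) addmC mcoeffMX.
apply: memN_msupp_eq0; rewrite (perm_mem (msuppMX _ _)).
by apply/mapP=> -[u' _ vE]; rewrite vE lem_addr in uv.
Qed.

Lemma incidenceM (p : Q) j s u : (incidence Q j s * p)@_u = incidence k j s * p@_u.
Proof.
rewrite /incidence; elim: #|_| => [|e IH]; first by rewrite !expr0 !mul1r.
by rewrite !exprS -!mulrA !mulN1r mcoeffN IH.
Qed.

(** The component of multidegree [u]: as the basis element of [s] has multidegree [L s], its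
    coefficient contributes the monomial [u - L s]. *)
Definition strand u w s : k := if (L s <= u)%MM then (w s)@_(u - L s) else 0.

Definition of_strand u c s : Q := if (L s <= u)%MM then c s *: 'X_[(u - L s)%MM] else 0.

(** Fixing the multidegree fixes every monomial factor, so only the signs of the Taylor differential
    remain. *)
Lemma strand_bd u w t : strand u (taylor_bd w) t = simplicial_bd (strand u w) t.
Proof.
rewrite /strand; case: ifP => tu; last first.
  rewrite /simplicial_bd big1 // => j jt; rewrite ifF ?mulr0 //.
  by rewrite lcm_monU1_le tu andbF.
rewrite raddf_sum; apply: eq_bigr => j jt /=; rewrite -mulrA incidenceM mcoeffMXE.
congr (_ * _); have tj := lcm_mon_sub m (subsetUr [set j] t).
have -> : (L (j |: t) - L t <= u - L t)%MM = (L (j |: t) <= u)%MM.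
  apply/mnm_lepP/mnm_lepP => H i; have := H i; rewrite !mnmBE;
    have /mnm_lepP/(_ i) := tj; have /mnm_lepP/(_ i) := tu.
    by move=> *; rewrite -(leq_sub2rE (p := L t i)).
  by move=> *; rewrite leq_sub2r.
case: ifP => // _; congr mcoeff; apply/mnmP => i; rewrite !mnmBE.
by rewrite subnBA ?subnK //; [have /mnm_lepP := tu | have /mnm_lepP := tj].
Qed.

Lemma eq_strand w z : (forall u, strand u w =1 strand u z) -> w =1 z.
Proof.
move=> wz s; apply/mpolyP => a; have := wz (a + L s)%MM s.
by rewrite /strand lem_addl addmK.
Qed.

Lemma strand0 u s : strand u (fun=> 0) s = 0.
Proof. by rewrite /strand mcoeff0 if_same. Qed.

Lemma eq_simplicial_bd c c' : c =1 c' -> simplicial_bd c =1 simplicial_bd c'.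
Proof. by move=> cc t; apply: eq_bigr => j _; rewrite cc. Qed.

Lemma eq_taylor_bd w z : w =1 z -> taylor_bd w =1 taylor_bd z.
Proof. by move=> wz t; apply: eq_bigr => j _; rewrite wz. Qed.

Lemma taylor_bd0 : taylor_bd (fun=> 0) =1 fun=> 0.
Proof. by move=> t; rewrite /taylor_bd big1 // => j _; rewrite mulr0 mul0r. Qed.

Lemma taylor_bd_bd w : taylor_bd (taylor_bd w) =1 fun=> 0.
Proof.
apply: eq_strand => u s; rewrite strand_bd (eq_simplicial_bd (strand_bd u w)).
by rewrite simplicial_bd_bd strand0.
Qed.

Lemma strand_of_strand u c : (forall s, c s != 0 -> (L s <= u)%MM) ->
  forall v, strand v (of_strand u c) =1 if v == u then c else fun=> 0.
Proof.
move=> cu v s; rewrite /strand /of_strand; case: eqVneq => [->|vu].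
  have [->|/cu ->] := eqVneq (c s) 0; first by rewrite scale0r if_same mcoeff0 if_same.
  by rewrite mcoeffZ mcoeffX eqxx mulr1.
case: ifP => // sv; case: ifP => su; last by rewrite mcoeff0.
rewrite mcoeffZ mcoeffX; case: eqP => [E|]; last by rewrite mulr0.
by case/eqP: vu; rewrite -(submK sv) -E submK.
Qed.

Lemma taylor_bd_of_strand u c : (forall s, c s != 0 -> (L s <= u)%MM) ->
  taylor_bd (of_strand u c) =1 of_strand u (simplicial_bd c).
Proof.
move=> cu; apply: eq_strand => v s; rewrite strand_bd.
rewrite (eq_simplicial_bd (strand_of_strand cu v)) strand_of_strand; last first.
  move=> t; apply: contraNT => tu; rewrite /simplicial_bd big1 // => j jt.
  have [->|/cu] := eqVneq (c (j |: t)) 0; first by rewrite mulr0.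
  by rewrite lcm_monU1_le (negPf tu) andbF.
case: eqP => // _; rewrite /simplicial_bd big1 // => j _; exact: mulr0.
Qed.

Lemma strand_neq0 u w s : strand u w s != 0 -> (L s <= u)%MM /\ w s != 0.
Proof.
rewrite /strand; case: ifP => [su H|_ /eqP//]; split=> //.
by apply: contraNneq H => ->; rewrite mcoeff0.
Qed.

Lemma strand_decomposition w :
  exists U : seq 'X_{1..n}, forall s, w s = \sum_(u <- U) of_strand u (strand u w) s.
Proof.
(* These are the multidegrees of all terms of [w]; [undup] makes each strand count once. *)
exists (undup (flatten [seq [seq (a + L s)%MM | a <- msupp (w s)] |
                        s <- enum {set 'I_q}])) => s.
set U := undup _; apply/mpolyP => a; rewrite raddf_sum /=.
have term0 u : u != (a + L s)%MM -> (of_strand u (strand u w) s)@_a = 0.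
  move=> /eqP ne; rewrite /of_strand; case: ifP => [su|]; last by rewrite mcoeff0.
  rewrite mcoeffZ mcoeffX; case: eqP => [E|]; last by rewrite mulr0.
  by case: ne; rewrite -E submK.
have term1 : (of_strand (a + L s) (strand (a + L s)%MM w) s)@_a = (w s)@_a.
  by rewrite /of_strand /strand lem_addl addmK mcoeffZ mcoeffX eqxx mulr1.
have [aU|aU] := boolP ((a + L s)%MM \in U).
  rewrite (bigD1_seq _ aU) ?undup_uniq //= term1 big1 ?addr0 // => u; exact: term0.
rewrite big_seq big1 => [|u uU]; last by apply: term0; apply: contraNneq aU => <-.
apply: memN_msupp_eq0; apply: contra aU => aw; rewrite mem_undup.
apply/flattenP; exists [seq (a + L s)%MM | a <- msupp (w s)]; last exact: map_f.
by apply: map_f; rewrite mem_enum.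
Qed.

Variable P : pred {set 'I_q}.

(* In each multidegree the part of the complex indexed by P is a cone. *)
Definition has_cone_points : Prop := forall u,
  (exists j, (m j <= u)%MM) ->
  exists2 j, (m j <= u)%MM & forall s, P s -> (L s <= u)%MM -> P (j |: s).

Definition chain i w : Prop := forall s, w s != 0 -> (#|s| == i) && P s.

(** The cycle is cut into its multidegree components. Each is a simplicial cycle, filled by the cone
    whose apex [has_cone_points] provides. *)
Lemma taylor_exact i w : has_cone_points -> chain i w -> taylor_bd w =1 (fun=> 0) ->
    (i = 0%N -> monomial_ideal m setT (w set0)) ->
  exists2 z, chain i.+1 z & taylor_bd z =1 w.
Proof.
move=> coneP cw bw w0; have [U Uw] := strand_decomposition w.
suff strandE u : exists2 z, chain i.+1 z & taylor_bd z =1 of_strand u (strand u w).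
  suff [z cz bz] : exists2 z, chain i.+1 z &
      taylor_bd z =1 fun s => \sum_(u <- U) of_strand u (strand u w) s.
    by exists z => // s; rewrite bz.
  elim: U {Uw} => [|u U [z cz bz]].
    by exists (fun=> 0) => [s /eqP//|s]; rewrite big_nil taylor_bd0.
  have [z' cz' bz'] := strandE u; exists (fun s => z' s + z s) => [s|s].
    by have [->|/cz' //] := eqVneq (z' s) 0; rewrite add0r; exact: cz.
  rewrite big_cons -bz' -bz /taylor_bd -big_split; apply: eq_bigr => j _ /=.
  by rewrite mulrDr mulrDl.
have [/existsP[s0 ws0]|] := boolP [exists s, strand u w s != 0]; last first.
  rewrite negb_exists => /forallP w00; exists (fun=> 0) => [s /eqP//|s].
  have /eqP sw := negbNE (w00 s); rewrite /of_strand sw scale0r if_same.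
  exact: taylor_bd0.
(* Some generator divides [u]: any vertex of a nonempty face of the strand gives one. If the face is
   empty, then [i] is 0, and the membership hypothesis makes a term of [w set0] divisible by a
   generator. *)
have [j ju Pj] : exists2 j, (m j <= u)%MM &
    forall s, P s -> (L s <= u)%MM -> P (j |: s).
  apply: coneP; have [s0u ws0'] := strand_neq0 ws0.
  have [s0E|[j js0]] := set_0Vmem s0; last first.
    by exists j; apply: lepm_trans s0u; apply: lcm_mon_ge.
  have i0 : i = 0%N by have /andP[/eqP <- _] := cw _ ws0'; rewrite s0E cards0.
  have [c cE] := w0 i0; move: ws0; rewrite /strand s0u s0E lcm_mon0 subm0 cE raddf_sum.
  have [/existsP[j ju]|] := boolP [exists j, (m j <= u)%MM]; first by exists j.
  rewrite negb_exists => /forallP nu; rewrite big1 ?eqxx //= => j _.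
  by rewrite mcoeffMXE (negPf (nu j)).
exists (of_strand u (cone j (strand u w))) => [s|].
  rewrite /of_strand /cone; case: ifP => [su|]; last by rewrite eqxx.
  case: ifP => [js|]; last by rewrite scale0r eqxx.
  have [->|/strand_neq0[s'u ws']] := eqVneq (strand u w (s :\ j)) 0.
    by rewrite mulr0 scale0r eqxx.
  have /andP[/eqP card_s' Ps'] := cw _ ws'; rewrite (cardsD1 j) js card_s' eqxx.
  by rewrite -(setD1K js) Pj.
move=> s; rewrite taylor_bd_of_strand; last first.
  move=> t; rewrite /cone; case: ifP => [jt|]; last by rewrite eqxx.
  have [->|/strand_neq0[t'u _] _] := eqVneq (strand u w (t :\ j)) 0.
    by rewrite mulr0 eqxx.
  by rewrite -(setD1K jt) lcm_monU1_le ju.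
rewrite /of_strand simplicial_bd_cone // => t; rewrite -strand_bd.
by rewrite /strand bw mcoeff0 if_same.
Qed.

(** * From functions on subsets back to based complexes *)

Hypothesis P_sub : forall s t, s \subset t -> P t -> P s.

Local Notation F := (taylor_part k m P).

Definition extend i (v : {ffun gen F i -> Q}) s : Q :=
  if insub s is Some x then v x else 0.

Definition restrict i w : {ffun gen F i -> Q} := [ffun x : gen F i => w (val x)].

Lemma extend_val i (v : {ffun gen F i -> Q}) x : extend v (val x) = v x.
Proof. by rewrite /extend valK. Qed.

Lemma extend_chain i (v : {ffun gen F i -> Q}) : chain i (extend v).
Proof. by move=> s; rewrite /extend; case: insubP => [x -> //|_ /eqP]. Qed.

Lemma extend_restrict i w : chain i w -> extend (restrict i w) =1 w.
Proof.
move=> cw s; rewrite /extend; case: insubP => [x _ <-|]; first by rewrite ffunE.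
by move/(contra (@cw s)); rewrite negbK => /eqP.
Qed.

Lemma extend0 i : extend (0 : {ffun gen F i -> Q}) =1 fun=> 0.
Proof. by move=> s; rewrite /extend; case: insubP => // x; rewrite ffunE. Qed.

Lemma extend_inj i (v v' : {ffun gen F i -> Q}) : extend v =1 extend v' -> v = v'.
Proof. by move=> vv; apply/ffunP => x; rewrite -!extend_val vv. Qed.

Lemma taylor_coefE w t : \sum_s w s * taylor_coef k m s t = taylor_bd w t.
Proof.
rewrite /taylor_coef; under eq_bigr do rewrite mulr_sumr.
rewrite (exchange_big_dep xpredT) //= /taylor_bd [RHS]big_mkcond.
apply: eq_bigr => j _; case: ifPn => jt; last first.
  rewrite big_pred0 // => s; apply/negP => /andP[js /eqP tE].
  by rewrite tE setD11 in jt.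
rewrite (big_pred1 (j |: t)) => [|s]; last first.
  apply/andP/eqP => [[js /eqP ->]|->]; first by rewrite setD1K.
  by rewrite setU11 setU1K.
rewrite setU1K // mulrA; congr (_ * _); rewrite mulrC; congr (_ * _).
by rewrite -[_ ^+ _]/(incidence Q j (j |: t)) incidenceU1 // ltnn mul1r.
Qed.

Lemma taylor_bd_supp w t : taylor_bd w t != 0 ->
  exists2 j, j \notin t & w (j |: t) != 0.
Proof.
move=> bt; have [/existsP[j /andP[jt wj]]|] :=
  boolP [exists j, (j \notin t) && (w (j |: t) != 0)]; first by exists j.
rewrite negb_exists => /forallP H; case/eqP: bt; rewrite /taylor_bd big1 // => j jt.
by have := H j; rewrite jt negbK => /eqP ->; rewrite mulr0 mul0r.
Qed.

Lemma taylor_bd_chain i w : chain i.+1 w -> chain i (taylor_bd w).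
Proof.
move=> cw t /taylor_bd_supp[j jt /cw /andP[cj Pj]].
rewrite cardsU1 jt in cj; rewrite -eqSS cj; exact: P_sub (subsetUr _ _) Pj.
Qed.

(** As [P] is closed under subsets, the boundary of a chain on [P] has no component outside [P], so
    nothing is lost by restriction. *)
Lemma extend_bd i (v : {ffun gen F i.+1 -> Q}) :
  extend (bd v) =1 taylor_bd (extend v).
Proof.
move=> t; rewrite {1}/extend; case: insubP => [x _ <-|Nt]; last first.
  by symmetry; apply/eqP; apply: contraNT Nt;
     apply: taylor_bd_chain (@extend_chain _ v) t.
rewrite ffunE -taylor_coefE /=.
rewrite [RHS](bigID (fun s => (#|s| == i.+1) && P s)) /= [X in _ = _ + X]big1.
  rewrite addr0 [RHS](big_sub (fun s => (#|s| == i.+1) && P s)) /=.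
  by apply: eq_bigr => a _; rewrite -extend_val.
move=> s Ns; have /eqP -> : extend v s == 0; last by rewrite mul0r.
by apply: contraNT Ns; exact: extend_chain.
Qed.

Lemma augment1E (v : {ffun gen F 0 -> Q}) : P set0 ->
  augment (fun=> 1) v = extend v set0.
Proof.
move=> P0; have h0 : (#|@set0 'I_q| == 0)%N && P set0 by rewrite cards0 eqxx.
pose b0 : gen F 0 := exist _ set0 h0.
rewrite -[set0]/(val b0) extend_val /augment (big_pred1 b0) ?mulr1 // => b /=.
by apply/esym/eqP/val_inj; case/andP: (valP b) => /eqP/cards0_eq.
Qed.

Lemma chain_bd0 w : chain 0 w -> taylor_bd w =1 fun=> 0.
Proof.
move=> cw t; apply/eqP; apply/negPn/negP => /taylor_bd_supp[j jt /cw /andP[]].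
by rewrite cardsU1 jt.
Qed.

Lemma taylor_part_resolves (I : Q -> Prop) :
  (forall p, I p <-> monomial_ideal m setT p) -> P set0 -> has_cone_points ->
  resolves I (fun _ : gen F 0 => 1).
Proof.
move=> hI P0 coneP; split=> [p|v|i v].
- exists [ffun=> p]; apply/hI; rewrite augment1E // /extend.
  case: insubP => [x _ _|]; last by rewrite cards0 eqxx P0.
  by rewrite ffunE subrr; have [] := ideal_gen_is_ideal (fun i => 'X_[k, m i]) setT.
- rewrite augment1E //; split=> [/hI Iv|[w ->]].
    have [z cz bz] := taylor_exact coneP (@extend_chain _ v)
      (chain_bd0 (@extend_chain _ v)) (fun=> Iv).
    exists (restrict 1 z); apply: extend_inj => s; rewrite extend_bd -bz.
    by apply/esym/eq_taylor_bd; exact: extend_restrict cz.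
  (* At the empty face, the boundary of a degree 1 chain is the combination of the generators with
     the chain's own coefficients. *)
  apply/hI; rewrite extend_bd; exists (fun j => extend w [set j]).
  apply: eq_big => [j|j _]; first by rewrite !inE.
  have -> : incidence Q j set0 = 1.
    rewrite /incidence; have -> : [set l : 'I_q in set0 | (l < j)%N] = set0.
      by apply/setP=> l; rewrite !inE.
    by rewrite cards0.
  by rewrite mul1r setU0 lcm_mon1 lcm_mon0 subm0.
- split=> [bv|[w ->]]; last first.
    apply: extend_inj => s; rewrite extend_bd (eq_taylor_bd (extend_bd w)).
    by rewrite taylor_bd_bd extend0.
  have bv0 : taylor_bd (extend v) =1 fun=> 0.
    by move=> s; rewrite -extend_bd bv extend0.
  have [|z cz bz] := taylor_exact coneP (@extend_chain _ v) bv0; first by [].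
  exists (restrict i.+2 z); apply: extend_inj => s; rewrite extend_bd -bz.
  by apply/esym/eq_taylor_bd; exact: extend_restrict cz.
Qed.

Lemma taylor_part_graded : graded (F := F) (fun=> 1).
Proof.
split=> [b u|i a b u] /=.
  have bE : val b = set0 by case/andP: (valP b) => /eqP/cards0_eq.
  by rewrite msupp1 inE bE lcm_mon0 => /eqP ->; rewrite mdeg0.
rewrite mcoeff_msupp /taylor_coef raddf_sum /= => nz.
suff [j bE uE] : exists2 j, val b = val a :\ j & u = (L (val a) - L (val a :\ j))%MM.
  rewrite uE -bE; have ba : (L (val b) <= L (val a))%MM.
    by rewrite bE lcm_mon_sub ?subD1set.
  by rewrite -{2}(submK ba) mdegD PoszD addrK.
have [/existsP[j /andP[/andP[_ /eqP bE] cj]]|] := boolP [exists j : 'I_q,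
   ((j \in val a) && (val b == val a :\ j)) &&
   (((-1) ^+ #|[set l in val a | (l < j)%N]| *
      'X_[(L (val a) - L (val a :\ j))%MM] : Q)@_u != 0)].
  exists j => //; apply/eqP; apply: contraNT cj => ne.
  rewrite -[_ ^+ _]/(incidence Q j (val a)) incidenceM mcoeffX.
  by rewrite (eq_sym _ u) (negPf ne) mulr0.
rewrite negb_exists => /forallP H; rewrite big1 ?eqxx // in nz => j jP.
by have := H j; rewrite jP negbK => /eqP.
Qed.

Lemma taylor_part_resolution (I : Q -> Prop) :
  (forall p, I p <-> monomial_ideal m setT p) -> P set0 -> has_cone_points ->
  graded_free_resolution I F.
Proof.
by exists (fun=> 1); [exact: taylor_part_graded | exact: taylor_part_resolves].
Qed.

End TaylorExactness.

(** * Pivot complexes that are resolutions *)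

Section PivotComplexes.
Variables (k : fieldType) (n q : nat) (m : 'I_q -> 'X_{1..n}).
Local Notation Q := {mpoly k[n]}.
Local Notation L := (lcm_mon m).
Variable I : Q -> Prop.
Hypothesis hI : forall p, I p <-> monomial_ideal m setT p.
Implicit Types (S s t : {set 'I_q}).

Lemma taylor_resolution : graded_free_resolution I (taylor_complex k m).
Proof. by apply: taylor_part_resolution => // u [j ju]; exists j. Qed.

Lemma avoiding_resolution S : (exists2 j, j \notin S & (m j <= L S)%MM) ->
  S != set0 -> graded_free_resolution I (taylor_avoiding k m S).
Proof.
move=> [j0 j0S j0L] S0; apply: taylor_part_resolution => //.
- by move=> s t st; apply: contra => /subset_trans; apply.
- by rewrite subset0.
(* If m_S divides [u], so does the generator [j0], and adding a vertex outside [S] never completes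
   [S]. Otherwise no face whose label divides [u] contains [S], even after [j] is added. *)
move=> u [j ju]; have [Su|Su] := boolP (L S <= u)%MM.
  exists j0 => [|s Ss _]; first exact: lepm_trans j0L Su.
  apply: contra Ss => /subsetP SU; apply/subsetP => i iS.
  by have /setU1P[ij|//] := SU i iS; rewrite -ij iS in j0S.
exists j => // s _ su; apply: contra Su => /(lcm_mon_sub m) SU.
by apply: lepm_trans SU _; rewrite lcm_monU1_le ju.
Qed.

(* If no other generator divided m_S, the boundary of epsilon_S would be a
   cycle of T_S that does not bound. *)
Lemma avoiding_resolution_label S : (2 <= #|S|)%N ->
  graded_free_resolution I (taylor_avoiding k m S) ->
  exists2 j, j \notin S & (m j <= L S)%MM.
Proof.
(* Writing the size of [S] as [i.+2] puts the boundary of epsilon_S in the positive degree [i.+1],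
   where [ex] applies. *)
move=> S2 [aug _ [_ _ ex]]; case cS: #|S| S2 => [|[|i]] // _.
pose P := fun s => ~~ (S \subset s).
pose e s : Q := (s == S)%:R.
have e_neq0 s : e s != 0 -> s = S by rewrite /e; case: (s =P S) => // _ /eqP.
have P_sub s t : s \subset t -> P t -> P s.
  by move=> st; apply: contra => /subset_trans; apply.
have cbe : chain P i.+1 (taylor_bd m e).
  move=> t /taylor_bd_supp[j jt /e_neq0 SE].
  have := cS; rewrite -SE cardsU1 jt add1n => -[->]; rewrite eqxx /= /P -SE.
  by apply: contra jt => /subsetP/(_ j); rewrite setU11; apply.
have [_ [w bw]] : bd (restrict m P i.+1 (taylor_bd m e)) = 0 /\
    exists w, restrict m P i.+1 (taylor_bd m e) = bd w.
  suff b0 : bd (restrict m P i.+1 (taylor_bd m e)) = 0 by split=> //; apply/ex.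
  apply: extend_inj => s; rewrite extend_bd // extend0.
  by rewrite (eq_taylor_bd _ (extend_restrict m cbe)) taylor_bd_bd.
(* Since [w] lives on faces not containing [S], this cycle of the full Taylor complex has
   coefficient 1 at [S]. *)
pose y s := e s - extend w s.
have by0 : taylor_bd m y =1 fun=> 0.
  move=> s; have -> : taylor_bd m y s = taylor_bd m e s - taylor_bd m (extend w) s.
    by rewrite /taylor_bd -sumrB; apply: eq_bigr => j _; rewrite mulrBr mulrBl.
  by rewrite -extend_bd // -bw extend_restrict // subrr.
have cy : chain predT i.+2 y.
  move=> s; rewrite andbT; have [->|sS] := eqVneq s S; first by rewrite cS.
  rewrite /y /e (negPf sS) sub0r oppr_eq0 => /(@extend_chain _ _ _ m P _ w).
  by case/andP.
have coneT : has_cone_points m predT by move=> u [j ju]; exists j.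
have [|z _ bz] := taylor_exact coneT cy by0; first by [].
have wS : extend w S = 0.
  rewrite /extend; case: insubP => // x; rewrite /P subxx andbF //.
(* The constant term 1 at [S] must come from some [j |: S] whose monomial factor is 1, which means
   that m_j divides m_S. *)
have := congr1 (mcoeff 0%MM) (bz S); rewrite /y /e eqxx wS subr0 mcoeff1 eqxx => H.
have [/existsP[j /andP[jS jL]]|] := boolP [exists j, (j \notin S) && (m j <= L S)%MM].
  by exists j.
rewrite negb_exists => /forallP N; have /eqP := H.
rewrite /taylor_bd raddf_sum /= big1 ?(eq_sym 0) ?oner_eq0 // => j jS.
rewrite mcoeffMXE ifF //; apply/negP => /mnm_lepP le0.
have /negP := N j; rewrite jS; apply; apply: lepm_trans (lcm_mon_ge m (setU11 j S)) _.
by apply/mnm_lepP => l; rewrite -subn_eq0 -leqn0; have := le0 l; rewrite mnmBE mnm0E.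
Qed.

(** * Ranks of pivot complexes *)

Lemma rank_taylor i : rank (taylor_complex k m) i = 'C(q, i).
Proof.
rewrite /rank card_sig -[q in RHS]card_ord -card_draws; apply: eq_card => s.
by rewrite !inE andbT.
Qed.

Lemma card_supersets S i :
  #|[set s : {set 'I_q} | (#|s| == i) && (S \subset s)]| =
  (if #|S| <= i then 'C(q - #|S|, i - #|S|) else 0)%N.
Proof.
case: leqP => Si; last first.
  apply/eqP; rewrite cards_eq0; apply/eqP/setP => s; rewrite !inE.
  by apply/negP => /andP[/eqP si /subset_leq_card]; rewrite si leqNgt Si.
have -> : (q - #|S| = #|~: S|)%N by rewrite [RHS]cardsCs setCK card_ord.
(* Supersets of [S] correspond to subsets of its complement by union with [S]. *)
rewrite -cards_draws; symmetry; rewrite -(card_in_imset (f := fun r => S :|: r)).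
  apply: eq_card => s; rewrite inE; apply/imsetP/andP => [[r]|[/eqP si Ss]].
    rewrite inE => /andP[rS /eqP ri] ->; rewrite subsetUl; split=> //.
    have /eqP : S :&: r = set0.
      by apply/eqP; rewrite setI_eq0 disjoint_sym disjoints_subset.
    by rewrite -cards_eq0 cardsU ri => /eqP ->; rewrite subn0 subnKC.
  exists (s :\: S); last by rewrite setDE setUIr setUCr setIT (setUidPr Ss).
  by rewrite inE cardsD (setIidPr Ss) si eqxx setDE subsetIr.
move=> r r'; rewrite !inE => /andP[rS _] /andP[r'S _] rr'.
have D (x : {set 'I_q}) : x \subset ~: S -> (S :|: x) :\: S = x.
  by move=> xS; rewrite setDUl setDv set0U setDE; apply/setIidPl.
by rewrite -(D r) // rr' D.
Qed.

Lemma binz_sub (l i : nat) : (l <= q)%N ->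
  binz (q%:Z - l%:Z) (i%:Z - l%:Z) = (if l <= i then 'C(q - l, i - l) else 0)%N.
Proof.
move=> lq; rewrite /binz subr_ge0 lez_nat; case: leqP => li //=.
rewrite lerD2r !subzn // !absz_nat; case: ifP => // /negbT.
rewrite -ltNge ltz_nat => iq; rewrite bin_small // ltn_sub2rE //.
Qed.

Lemma binz_nat (i : nat) : binz q i = 'C(q, i).
Proof. by have := @binz_sub 0 i (leq0n _); rewrite !subr0 !subn0. Qed.

Lemma rank_avoiding S (i : nat) :
  (rank (taylor_avoiding k m S) i)%:Z =
  binz q i - binz (q%:Z - #|S|%:Z) (i%:Z - #|S|%:Z).
Proof.
have Sq : (#|S| <= q)%N by rewrite -[q in leqRHS]card_ord max_card.
apply/eqP; rewrite eq_sym subr_eq binz_nat binz_sub // -card_supersets -PoszD.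
rewrite /rank card_sig -[q in X in X == _]card_ord -card_draws.
rewrite -(cardsID [set s : {set 'I_q} | S \subset s]
                  [set s : {set 'I_q} | #|s| == i]) addnC.
by apply/eqP; congr (Posz (_ + _)); apply: eq_card => s; rewrite !inE // andbC.
Qed.

(** * Repeated labels and the Scarf number *)

Hypothesis hmin : forall A : {set 'I_q},
  (forall p, I p <-> monomial_ideal m A p) -> A = setT.
Hypothesis hproper : ideal_proper I.

Lemma generator_in j : I 'X_[m j].
Proof. exact/hI/ideal_gen_mem. Qed.

Lemma generator_neq0 j : m j != 0%MM.
Proof.
apply/eqP => mj; apply: hproper; have := generator_in j.
by rewrite mj mpolyX0.
Qed.

(** Otherwise [m i] would be a redundant generator, contradicting minimality. *)
Lemma generator_antichain i j : (m j <= m i)%MM -> i = j.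
Proof.
move=> mji; apply/eqP/negPn/negP => ij.
suff /hmin/setP/(_ i) : forall p, I p <-> monomial_ideal m [set~ i] p.
  by rewrite !inE eqxx.
have idA := ideal_gen_is_ideal (fun l => 'X_[k, m l]) [set~ i].
have idT := ideal_gen_is_ideal (fun l => 'X_[k, m l]) setT.
move=> p; split=> [/hI[c ->]|[c ->]].
  apply: ideal_sum => // l _; have [_ _ iM] := idA; apply: (iM).
  have [->|li] := eqVneq l i; last by apply: ideal_gen_mem; rewrite !inE.
  rewrite -(submK mji) mpolyXD; apply: iM; apply: ideal_gen_mem.
  by rewrite !inE eq_sym.
apply/hI; apply: ideal_sum => // l _; have [_ _ iM] := idT; apply: iM.
exact: ideal_gen_mem.
Qed.

Lemma repeated_labelP s :
  reflect (exists2 t, s != t & L s = L t) (repeated_label m s).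
Proof.
apply: (iffP existsP) => [[t /andP[st /eqP E]]|[t st E]]; exists t => //.
by rewrite st E eqxx.
Qed.

(** The empty set shares its label 1 with no other set because no generator is 1, and a singleton
    shares its label with none because the generators form an antichain. This makes [S] eligible for
    a pivot complex. *)
Lemma repeated_label_card s : repeated_label m s -> (2 <= #|s|)%N.
Proof.
move=> /repeated_labelP[t st E].
have L0 r : L r = 0%MM -> r = set0.
  move=> r0; have [//|[j jr]] := set_0Vmem r.
  have := lcm_mon_ge m jr; rewrite r0 => j0; case/negP: (generator_neq0 j).
  by apply/eqP/lepm_anti => //; apply/mnm_lepP => i; rewrite mnm0E.
rewrite ltnNge leq_eqVlt ltnS leqn0 cards_eq0.
apply/negP => /orP[/cards1P[i sE]|/eqP s0].
  have [tsub|/subsetPn[j jt]] := boolP (t \subset [set i]).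
    have [t0|[j jt]] := set_0Vmem t.
      by have /L0/setP/(_ i) : L s = 0%MM; [rewrite E t0 lcm_mon0|rewrite sE !inE eqxx].
    case/negP: st; rewrite sE eqEsubset tsub andbT sub1set.
    by have /set1P <- := subsetP tsub j jt.
  have := lcm_mon_ge m jt; rewrite -E sE lcm_mon1 => /generator_antichain ->.
  by rewrite set11.
by case/negP: st; rewrite s0 eq_sym; apply/eqP/L0; rewrite -E s0 lcm_mon0.
Qed.

Lemma repeated_label_cone S j : j \notin S -> (m j <= L S)%MM -> repeated_label m S.
Proof.
move=> jS jL; apply/repeated_labelP; exists (j |: S).
  by apply: contraNneq jS => ->; rewrite setU11.
by rewrite lcm_monU1_id.
Qed.

Variant scarf_spec : option nat -> Prop :=
| ScarfInfinite of (forall s, ~~ repeated_label m s) : scarf_spec None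
| ScarfFinite S of repeated_label m S &
    (forall s, repeated_label m s -> #|S| <= #|s|)%N : scarf_spec (Some #|S|).

Lemma scarfP : scarf_spec (scarf_number m).
Proof.
rewrite /scarf_number; case: pickP => [s0 rs0|no]; last first.
  by constructor => s; rewrite no.
by case: arg_minnP => // S rS minS; constructor.
Qed.

(** A set [t] with the label of [S] is itself a repeated label, so minimality keeps it from being a
    proper subset of [S]. An element of [t] outside [S] then serves. *)
Lemma minimal_repeated_cone S : repeated_label m S ->
  (forall s, repeated_label m s -> #|S| <= #|s|)%N ->
  exists2 j, j \notin S & (m j <= L S)%MM.
Proof.
move=> /repeated_labelP[t St E] minS.
have [tS|/subsetPn[j jt jS]] := boolP (t \subset S); last first.
  by exists j => //; rewrite E lcm_mon_ge.
have /minS : repeated_label m t.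
  by apply/repeated_labelP; exists S => //; rewrite eq_sym.
by rewrite leqNgt proper_card // properEneq eq_sym St.
Qed.

Lemma scarf_pivot_resolution : exists G,
  [/\ pivot_complex m G, graded_free_resolution I G &
      forall i : nat,
        (rank G i)%:Z = binz q i - shifted_binz q i (scarf_number m)].
Proof.
case: scarfP => [_|S rS minS].
  exists (taylor_complex k m); split; [by left|exact: taylor_resolution|].
  by move=> i; rewrite rank_taylor subr0 binz_nat.
have S2 := repeated_label_card rS.
exists (taylor_avoiding k m S); split; last exact: rank_avoiding.
  by right; exists S.
apply: avoiding_resolution; first exact: minimal_repeated_cone.
by rewrite -cards_eq0 -lt0n (ltn_trans _ S2).
Qed.

Lemma scarf_le (t : nat) : scarf_number m = Some t -> (2 <= t <= q)%N.
Proof.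
case: scarfP => // S rS _ [<-]; rewrite repeated_label_card //=.
by rewrite -[q in leqRHS]card_ord max_card.
Qed.

(** This is the lowest degree with a nonzero correction, and the one in which [minimal_pivot_rank]
    compares ranks. *)
Lemma shifted_binz_scarf (t : nat) : scarf_number m = Some t ->
  shifted_binz q t (Some t) = 1.
Proof.
move/scarf_le/andP => [_ tq]; rewrite /= binz_sub // leqnn subnn bin0 //.
Qed.

Lemma minimal_pivot_rank (F : based_complex k n) :
  pivot_complex m F -> graded_free_resolution I F -> minimal F ->
  forall i : nat, (rank F i)%:Z = binz q i - shifted_binz q i (scarf_number m).
Proof.
move=> pivF gF minF; have [aF _ resF] := gF.
have idealI := eq_is_ideal hI (ideal_gen_is_ideal _ _).
have rank_le (i : nat) : (rank F i)%:Z <= binz q i - shifted_binz q i (scarf_number m).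
  have [G [_ [aG _ resG] rkG]] := scarf_pivot_resolution.
  by rewrite -rkG lez_nat; exact: minimal_rank_le resF resG minF i.
case: pivF gF rank_le {minF aF resF} => [->|[S S2 ->]] gF rank_le i.
  suff -> : scarf_number m = None by rewrite subr0 rank_taylor binz_nat.
  (* With a finite Scarf number [t], the Taylor rank in degree [t] would exceed the bound by 1. *)
  case E: (scarf_number m) => [t|//]; have := rank_le t.
  rewrite E (shifted_binz_scarf E) rank_taylor binz_nat lerBrDr gerDl.
  by rewrite ler10.
have [j jS jL] := avoiding_resolution_label S2 gF.
rewrite rank_avoiding; congr (_ - _).
case: scarfP (rank_le) shifted_binz_scarf scarf_le =>
  [/(_ S)/negP[]|S0 rS0 minS0 le sh sc].
  exact: repeated_label_cone jL.
suff -> : #|S| = #|S0| by [].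
apply/eqP; rewrite eqn_leq minS0 ?(repeated_label_cone jS jL) // andbT.
(* In degree [#|S0|] the bound subtracts 1, so the correction for [S] is nonzero there, which forces
   [#|S|] to be at most [#|S0|]. *)
have := le #|S0|; rewrite (sh _ erefl) rank_avoiding lerD2l lerN2 binz_sub.
  by case: leqP.
by rewrite -[q in leqRHS]card_ord max_card.
Qed.

End PivotComplexes.

(** * The bound on the Betti numbers and the case of equality *)

Theorem corollary3p9 (k : fieldType) (n : nat) (I : {mpoly k[n]} -> Prop)
    (q : nat) (m : 'I_q -> 'X_{1..n})
    (hgen : minimal_monomial_generators I m) (hproper : ideal_proper I) :
  (forall i : int,
     (betti I i)%:Z <= binz q%:Z i - shifted_binz q i (scarf_number m)) /\
  ((forall i : int,
      (betti I i)%:Z = binz q%:Z i - shifted_binz q i (scarf_number m)) <->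
   has_minimal_pivot_resolution m I).
Proof.
have [hI hmin] := hgen.
have idealI := eq_is_ideal hI (ideal_gen_is_ideal _ _).
have [G [pivG gG rkG]] := scarf_pivot_resolution hI hmin hproper.
have [aG _ resG] := gG.
have neg e : binz q (Negz e) - shifted_binz q (Negz e) (scarf_number m) = 0.
  have binz_neg a b : b < 0 -> binz a b = 0 by rewrite /binz leNgt => ->.
  rewrite /shifted_binz; case: scarf_number => [t|]; rewrite !binz_neg //.
  by rewrite NegzE -opprD -PoszD oppr_lt0.
split=> [[i|e]|]; first by rewrite -rkG lez_nat; exact: betti_nat_le resG i.
  by rewrite neg.
split=> [bettiE|[F [pivF gF minF]] [i|e]].
(* Equality says that the Betti numbers are the ranks of [G], which forces [G] to be minimal. *)
- exists G; split=> //; have rkE (i : nat) : betti_nat I i = rank G i.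
    by have := bettiE i; rewrite -rkG => -[].
  apply: (betti_nat_minimal idealI resG) => //.
  (* [G] has rank 1 in degree 0: the correction vanishes there because the Scarf number is
     positive. *)
  rewrite -ltz_nat rkG binz_nat bin0; case E: scarf_number => [t|] //=.
  have /andP[t2 tq] := scarf_le hI hmin hproper E.
  by rewrite binz_sub // leqNgt (ltn_trans _ t2).
- by rewrite /= (betti_natE idealI gF minF) (minimal_pivot_rank hI hmin hproper pivF).
- by rewrite neg.
Qed.
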